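(* Let $\kappa>\frac12$. For every probability measure $\mu$ on $(-1,1)$ and every $s\ge 0$, $$\lim_{t\to\infty}\mathbb{P}_{\mu,s}(X_t\in\cdot\mid \tau_X>t)=\delta_0,$$ where the limit is in the sense of weak convergence of probability measures.
   Context: Let $\kappa>0$. For $s\ge 0$ and $x\in\mathbb{R}$, let $\mathbb{P}_{x,s}$ be a probability measure under which the process $(X_t)_{t\ge s}$ is given by $X_t=\frac{x(s+1)^\kappa+W_{t-s}}{(t+1)^\kappa}$, where $(W_u)_{u\ge0}$ is a standard one-dimensional Brownian motion started at $0$; equivalently $X_t=B_t/(t+1)^\kappa$ with $B$ a Brownian motion satisfying $B_s=x(s+1)^\kappa$, so that $\mathbb{P}_{x,s}(X_s=x)=1$. Let $\tau_X:=\inf\{t\ge s:|X_t|=1\}$. For a probability measure $\mu$ on $(-1,1)$, $\mathbb{P}_{\mu,s}:=\int\mathbb{P}_{x,s}\,\mu(dx)$. $\delta_0$ is the Dirac mass at $0$. *)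

(* Defs.v *)
From HB Require Import structures.
From mathcomp Require Import all_boot all_order all_algebra.
From mathcomp Require Import all_classical all_reals all_analysis.
Set Implicit Arguments. Unset Strict Implicit. Unset Printing Implicit Defensive.
Import Order.TTheory GRing.Theory Num.Theory numFieldNormedType.Exports.
Local Open Scope classical_set_scope.
Local Open Scope ring_scope.

(* A standard one-dimensional Brownian motion started at 0 on the probability
   space (Omega, P), indexed by times u >= 0 (values at negative times are
   irrelevant): W_0 = 0, continuous paths on [0,+oo), each W_u measurable, and
   for every finite increasing family of times 0 <= t_0 < ... < t_n the
   increments W_{t_{i+1}} - W_{t_i} are independent N(0, t_{i+1} - t_i)
   (their joint law is the product of the centred Gaussian laws with standard
   deviation sqrt(t_{i+1} - t_i)). *)
Definition is_standard_BM {d} {Omega : measurableType d} {R : realType}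
  (P : probability Omega R) (W : R -> Omega -> R) : Prop :=
  [/\ forall w, W 0 w = 0,
      forall w, {within [set u : R | 0 <= u], continuous ((fun u => W u w) : R -> R)},
      forall u, measurable_fun setT (W u) &
      forall (n : nat) (ts : 'I_n.+1 -> R) (B : 'I_n -> set R),
        0 <= ts ord0 ->
        (forall i : 'I_n, ts (widen_ord (leqnSn n) i) < ts (lift ord0 i)) ->
        (forall i, measurable (B i)) ->
        P (\bigcap_(i in [set: 'I_n])
             [set w | B i (W (ts (lift ord0 i)) w - W (ts (widen_ord (leqnSn n) i)) w)])
        = (\prod_(i < n)
             normal_prob 0 (Num.sqrt (ts (lift ord0 i) - ts (widen_ord (leqnSn n) i))) (B i))%E].

(* Under P_{x,s}: X_t = (x (s+1)^kappa + W_{t-s}) / (t+1)^kappa, for t >= s. *)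
Definition Xproc {Omega : Type} {R : realType} (kappa s x : R)
  (W : R -> Omega -> R) (t : R) (w : Omega) : R :=
  (x * (s + 1) `^ kappa + W (t - s) w) / (t + 1) `^ kappa.

Definition tauX {Omega : Type} {R : realType} (kappa s x : R)
  (W : R -> Omega -> R) (w : Omega) : \bar R :=
  ereal_inf [set u%:E | u in [set u | s <= u /\ `|Xproc kappa s x W u w| = 1]].

Definition survive {Omega : Type} {R : realType} (kappa s x : R)
  (W : R -> Omega -> R) (t : R) : set Omega :=
  [set w | (t%:E < tauX kappa s x W w)%E].

Definition surv_prob {d} {Omega : measurableType d} {R : realType}
  (P : probability Omega R) (mu : probability R R) (kappa s : R)
  (W : R -> Omega -> R) (t : R) : \bar R :=
  (\int[mu]_x P (survive kappa s x W t))%E.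

Definition surv_expect {d} {Omega : measurableType d} {R : realType}
  (P : probability Omega R) (mu : probability R R) (kappa s : R)
  (W : R -> Omega -> R) (f : R -> R) (t : R) : \bar R :=
  (\int[mu]_x \int[P]_(w in survive kappa s x W t) (f (Xproc kappa s x W t w))%:E)%E.

Definition cond_integral {d} {Omega : measurableType d} {R : realType}
  (P : probability Omega R) (mu : probability R R) (kappa s : R)
  (W : R -> Omega -> R) (f : R -> R) (t : R) : R :=
  fine (surv_expect P mu kappa s W f t) / fine (surv_prob P mu kappa s W t).

Definition cond_law_weakly_to_dirac0 {d} {Omega : measurableType d} {R : realType}
  (P : probability Omega R) (mu : probability R R) (kappa s : R)
  (W : R -> Omega -> R) : Prop :=
  forall f : R -> R, continuous f -> (exists M : R, forall y, `|f y| <= M) ->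
    cond_integral P mu kappa s W f t @[t --> +oo] --> f 0.

(* Main.v *)
(* Since kappa > 1/2, the boundary (t+1)^kappa outgrows the diffusive scale, so
   the process survives forever with positive probability, bounded below
   uniformly over starting points in a compact subset of (-1,1): keep the
   Brownian path in a tiny ball up to a large time T (small-ball estimate), then
   keep its increments after T below (2^n T / 2)^kappa / 2 on [T, T + 2^n T] for
   every n (Ottaviani's maximal inequality and a convergent geometric series).
   On the other hand B_t / (t+1)^kappa tends to 0 in probability, and
   conditioning on events of probability bounded below preserves this.
   All estimates on W are proved on a dyadic grid, uniformly in the mesh, and
   transferred to the whole path by continuity. *)
Require Import Defs.
From HB Require Import structures.
From mathcomp Require Import all_boot all_order all_algebra.
From mathcomp Require Import all_classical all_reals all_analysis.
From mathcomp Require Import measurable_realfun ring lra zify.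
Import Order.TTheory GRing.Theory Num.Theory numFieldNormedType.Exports.
Local Open Scope classical_set_scope.
Local Open Scope ring_scope.

Set Implicit Arguments. Unset Strict Implicit. Unset Printing Implicit Defensive.

(** * Gaussian estimates *)

(** Both uses of $\kappa>1/2$ rest on one quantity, the variance $u$ at time scale $u$ divided by
    the squared boundary $u^{2\kappa}$. The ratio $u^{1-2\kappa}$ is summable along $u=2^n v$, which
    controls the hitting probabilities, and tends to 0, which gives $B_t/(t+1)^\kappa\to 0$. A crude
    Gaussian tail of Chebyshev type is therefore enough. The delicate point is a survival bound
    independent of the mesh and of the horizon. The sum over scales is small only from a large time
    on, while the boundary could be hit earlier; hence the confinement phase, whose cost counts
    blocks of fixed duration $e^2/512$ and not grid steps. The two phases combine because each
    maximal estimate is relative to a past event and carries its probability as a factor: the later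
    losses total at most half of the confinement probability. *)

Section normal.
Context {R : realType}.
Implicit Types sg l : R.

(* Exponential tilting: on the far side of [l], the centred density is at most
   [exp (- l^2 / (2 sg^2))] times the density centred at [l], whose total mass
   is 1; this gives the Gaussian tail without integrating it. *)
Lemma normal_pdf_shift sg l x : 0 < sg -> 0 <= l * (x - l) ->
  normal_pdf 0 sg x <= expR (- (l ^+ 2 / (sg ^+ 2 *+ 2))) * normal_pdf l sg x.
Proof.
move=> sg0 lx; rewrite !normal_pdfE ?gt_eqF// mulrCA ler_pM2l; last first.
  by apply: normal_peak_gt0; rewrite gt_eqF.
rewrite /normal_fun -expRD ler_expR !mulNr subr0 -opprD -mulrDl lerN2.
(* Here $x^2 = l^2 + (x-l)^2 + 2l(x-l)$, and the cross term is nonnegative. *)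
rewrite ler_pM2r; first by nra.
by rewrite invr_gt0 mulrn_wgt0// exprn_gt0.
Qed.

(** The condition [0 <= l * (x - l)] puts [A] beyond [l] on the side given by the sign of [l], so
    one statement serves both tails. *)
Lemma normal_prob_shift sg l (A : set R) : 0 < sg -> measurable A ->
  (forall x, A x -> 0 <= l * (x - l)) ->
  (normal_prob 0 sg A <= (expR (- (l ^+ 2 / (sg ^+ 2 *+ 2))))%:E)%E.
Proof.
move=> sg0 mA Al; set c := expR _.
have c0 : 0 <= c by exact: expR_ge0.
rewrite /normal_prob.
apply: (@le_trans _ _ (\int[lebesgue_measure]_(x in A) (c%:E * (normal_pdf l sg x)%:E))%E).
  apply: ge0_le_integral => //.
  - by move=> x _; rewrite lee_fin normal_pdf_ge0.
  - by apply/measurable_EFinP; apply: measurable_funTS; exact: measurable_normal_pdf.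
  - apply/measurable_EFinP; apply: measurable_funTS.
    apply: measurable_funM => //; exact: measurable_normal_pdf.
  - by move=> x Ax; rewrite -EFinM lee_fin; apply: normal_pdf_shift => //; exact: Al.
rewrite ge0_integralZl_EFin//; last 2 first.
- by move=> x _; rewrite lee_fin normal_pdf_ge0.
- by apply/measurable_EFinP; apply: measurable_funTS; exact: measurable_normal_pdf.
rewrite -[leRHS]mule1; apply: lee_wpmul2l => //.
have := @probability_le1 _ _ _ (@normal_prob R l sg) A mA.
by [].
Qed.

Lemma measurable_norm_ge l : measurable [set x : R | (l <= `|x|)%R].
Proof.
rewrite -[X in measurable X]setTI.
have : measurable_fun [set: R] (fun x : R => `|x|) by exact: measurableT_comp.
move=> /(_ measurableT `[l, +oo[%classic (measurable_itv _)).
by congr (measurable (_ `&` _)); apply/seteqP; split=> x/=; rewrite in_itv/= andbT.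
Qed.

(** Each tail is at most $e^{-y}\le 1/y$ with $y=l^2/(2\,sg^2)$. This is Chebyshev's inequality with
    constant 4; only the ratio of variance to squared threshold matters later. *)
Lemma normal_prob_norm_ge sg l : 0 < sg -> 0 < l ->
  (normal_prob 0 sg [set x | (l <= `|x|)%R] <= (4 * sg ^+ 2 / l ^+ 2)%:E)%E.
Proof.
move=> sg0 l0.
have tail : expR (- (l ^+ 2 / (sg ^+ 2 *+ 2))) <= 2 * sg ^+ 2 / l ^+ 2.
  rewrite expRN -[leRHS]invrK lef_pV2 ?posrE ?expR_gt0//; last first.
    by rewrite invr_gt0 divr_gt0// ?mulr_gt0// exprn_gt0.
  have -> : (2 * sg ^+ 2 / l ^+ 2)^-1 = l ^+ 2 / (sg ^+ 2 *+ 2).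
    by rewrite -(mulr_natl (sg ^+ 2)); field; rewrite !gt_eqF.
  by apply: le_trans (expR_ge1Dx _); rewrite lerDr.
have -> : [set x : R | l <= `|x|] = `[l, +oo[%classic `|` `]-oo, - l]%classic.
  apply/seteqP; split => x /=; rewrite !in_itv/= ?andbT ler_normr lerNr.
    by case/orP => ?; [left|right].
  by case => ->; rewrite ?orbT.
apply: le_trans (measureU2 _ _ _) _ => //=.
have -> : 4 * sg ^+ 2 / l ^+ 2 = 2 * sg ^+ 2 / l ^+ 2 + 2 * sg ^+ 2 / l ^+ 2.
  by field; rewrite gt_eqF.
rewrite EFinD; apply: leeD.
  apply: le_trans (_ : (_ <= (expR (- (l ^+ 2 / (sg ^+ 2 *+ 2))))%:E)%E) _.
    apply: normal_prob_shift => // x /=; rewrite in_itv/= andbT => lx.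
    by rewrite mulr_ge0 ?(ltW l0)// subr_ge0.
  by rewrite lee_fin.
apply: le_trans (_ : (_ <= (expR (- ((- l) ^+ 2 / (sg ^+ 2 *+ 2))))%:E)%E) _.
  apply: normal_prob_shift => // x /=; rewrite in_itv/= => lx.
  by rewrite mulr_le0 ?oppr_le0 ?(ltW l0)// subr_le0.
by rewrite sqrrN lee_fin.
Qed.

(** The reflection $x\mapsto -x$ gives the two half-lines equal mass, and together they cover the
    line. *)
Lemma normal_prob_half sg : 0 < sg ->
  ((2^-1)%:E <= normal_prob 0 sg `[0%R, +oo[)%E /\
  ((2^-1)%:E <= normal_prob 0 sg `]-oo, 0%R])%E.
Proof.
move=> sg0.
have E : normal_prob 0 sg `[0, +oo[ = normal_prob 0 sg `]-oo, 0%R].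
  rewrite /normal_prob ge0_integration_by_substitution0//.
  - apply: eq_integral => x _; congr EFin.
    by rewrite !normal_pdfE ?gt_eqF// /normal_fun !subr0 sqrrN.
  - by apply/measurable_EFinP; exact: measurable_normal_pdf.
  - by move=> x; rewrite lee_fin normal_pdf_ge0.
have : (1%:E <= normal_prob 0 sg `[0%R, +oo[ + normal_prob 0 sg `]-oo, 0%R])%E.
  rewrite -(@probability_setT _ _ _ (@normal_prob R 0 sg)).
  rewrite (_ : setT = `[0%R, +oo[%classic `|` `]-oo, 0%R]%classic).
    by apply: measureU2.
  apply/seteqP; split => // x _ /=; rewrite !in_itv/= andbT.
  by have [|/ltW] := leP 0 x; [left|right].
rewrite E.
have : normal_prob 0 sg `]-oo, 0%R] \is a fin_num.
  exact: (fin_num_measure (@normal_prob R 0 sg)).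
move: (normal_prob _ _ _) => [z||]// _; rewrite -EFinD !lee_fin; lra.
Qed.

End normal.

(** * The Brownian path on a grid *)

Section walk.
Context {d : measure_display} {Omega : measurableType d} {R : realType}
  (P : probability Omega R) (W : R -> Omega -> R) (hW : is_standard_BM P W)
  (h : R) (h0 : 0 < h).

Definition walk (k : nat) (w : Omega) : R := W (k%:R * h) w.

(* Working on a fixed grid, the cylinders of the first [k] increments form a
   pi-system on which the finite-dimensional laws of [W] factorize. *)
Definition cylinder (k : nat) : set (set Omega) :=
  [set A | exists2 B : nat -> set R, forall i, measurable (B i) &
    A = \bigcap_(i in `I_k) [set w | B i (walk i.+1 w - walk i w)]].

Definition past (k : nat) : set (set Omega) := <<s cylinder k >>.

Lemma measurable_walk k : measurable_fun setT (walk k).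
Proof. by case: hW => _ _ + _; apply. Qed.

Lemma walk0 w : walk 0 w = 0.
Proof. by rewrite /walk mul0r; case: hW => + _ _ _; apply. Qed.

Lemma cylinder_setI k : setI_closed (cylinder k).
Proof.
move=> _ _ [B mB ->] [C mC ->]; exists (fun i => B i `&` C i).
  by move=> i; exact: measurableI.
by rewrite -bigcapI.
Qed.

Lemma cylinder_measurable k : cylinder k `<=` measurable.
Proof.
move=> _ [B mB ->]; apply: bigcap_measurableType => i _.
rewrite -[X in measurable X]setTI.
have : measurable_fun setT (fun w => walk i.+1 w - walk i w).
  by apply: measurable_funB; exact: measurable_walk.
by move=> /(_ measurableT _ (mB i)).
Qed.

Lemma past_measurable k : past k `<=` measurable.
Proof.
apply: smallest_sub; first exact: sigma_algebra_measurable.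
exact: cylinder_measurable.
Qed.

Lemma past_le k l : (k <= l)%N -> past k `<=` past l.
Proof.
move=> kl; apply: smallest_sub; first exact: smallest_sigma_algebra.
move=> _ [B mB ->]; apply: sub_gen_smallest.
exists (fun i => if (i < k)%N then B i else setT).
  by move=> i; case: ifP.
apply/seteqP; split => w /= Bw i /=.
  by move=> il; case: ifP => // ik; exact: Bw.
by move=> ik; have := Bw i (leq_trans ik kl); rewrite /= ik.
Qed.

(** Carrying [past k] as the sigma-algebra of a type makes the general measurability lemmas apply to
    it. *)
Local Notation T k := (g_sigma_algebraType (cylinder k)).

Lemma past_walkB i k : (i < k)%N ->
  measurable_fun setT (fun w : T k => walk i.+1 w - walk i w).
Proof.
move=> ik _ B mB; rewrite setTI; apply: sub_gen_smallest.
exists (fun j => if j == i then B else setT); first by move=> j; case: ifP.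
apply/seteqP; split => w /= Bw; last by have := Bw i ik; rewrite /= eqxx.
by move=> j _ /=; case: eqP => // ->.
Qed.

Lemma past_walk j k : (j <= k)%N -> measurable_fun setT (walk j : T k -> R).
Proof.
move=> jk.
(* The guard [i < k] holds for all [i < j]; it makes every summand measurable, as [measurable_sum]
   asks for each index. *)
have -> : (walk j : T k -> R) = (fun w => \sum_(0 <= i < j)
    (if (i < k)%N then walk i.+1 w - walk i w else 0)).
  apply/funext => w; transitivity (walk j w - walk 0 w); first by rewrite walk0 subr0.
  rewrite -(telescope_sumr (walk^~ w) (leq0n j)).
  by apply: eq_big_nat => i /andP[_ ij]; rewrite (leq_trans ij jk).
apply: (@measurable_sum _ (T k) R setT nat (index_iota 0 j)
  (fun i w => if (i < k)%N then walk i.+1 w - walk i w else 0)) => i.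
by case E: (i < k)%N; [exact: past_walkB|exact: measurable_cst].
Qed.

Lemma pastT k : past k setT.
Proof. exact: (@measurableT _ (T k)). Qed.

Lemma pastI k A B : past k A -> past k B -> past k (A `&` B).
Proof. exact: (@measurableI _ (T k)). Qed.

Lemma past_pre k (f : T k -> R) (B : set R) :
  measurable_fun setT f -> measurable B -> past k (f @^-1` B).
Proof. by move=> mf mB; have := mf measurableT _ mB; rewrite setTI. Qed.

Lemma past_bigcap k (F : nat -> set Omega) (J : set nat) :
  (forall j, J j -> past k (F j)) -> past k (\bigcap_(j in J) F j).
Proof. exact: (@bigcap_measurableType _ (T k)). Qed.

Lemma past_bigcup k (F : nat -> set Omega) (J : set nat) :
  (forall j, J j -> past k (F j)) -> past k (\bigcup_(j in J) F j).
Proof. exact: (@bigcup_measurable _ (T k)). Qed.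

Lemma cylinder_prob k N (B : nat -> set R) (C : set R) : (k < N)%N ->
  (forall i, measurable (B i)) -> measurable C ->
  P ((\bigcap_(i in `I_k) [set w | B i (walk i.+1 w - walk i w)]) `&`
     [set w | C (walk N w - walk k w)]) =
  (\prod_(i < k) normal_prob 0 (Num.sqrt (i.+1%:R * h - i%:R * h)) (B i) *
   normal_prob 0 (Num.sqrt (N%:R * h - k%:R * h)) C)%E.
Proof.
move=> kN mB mC; case: hW => _ _ _ H.
(* The times are $0,h,\dots,kh$ and then $Nh$: the last of the [k.+1] increments jumps from [k] to
   [N]. *)
pose tn (i : nat) := if (i < k.+1)%N then i else N.
pose ts (i : 'I_k.+2) : R := (tn i)%:R * h.
pose D (i : 'I_k.+1) := if (i < k)%N then B i else C.
have tw (i : 'I_k.+1) : ts (widen_ord (leqnSn k.+1) i) = i%:R * h.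
  by rewrite /ts /tn /= ltn_ord.
have tl (i : 'I_k.+1) : ts (lift ord0 i) = (if (i < k)%N then i.+1 else N)%:R * h.
  by rewrite /ts /tn /= /bump leq0n add1n ltnS.
have := H k.+1 ts D; rewrite {1}/ts /= mul0r lexx => /(_ isT) {}H.
have -> : (\prod_(i < k) normal_prob 0 (Num.sqrt (i.+1%:R * h - i%:R * h)) (B i) *
   normal_prob 0 (Num.sqrt (N%:R * h - k%:R * h)) C =
  \prod_(i < k.+1) normal_prob 0 (Num.sqrt (ts (lift ord0 i) -
     ts (widen_ord (leqnSn k.+1) i))) (D i))%E.
  rewrite big_ord_recr; apply: (f_equal2 mule).
    apply: eq_bigr => i _; rewrite tw tl /D.
    by have -> : (widen_ord (leqnSn k) i < k)%N by rewrite /= ltn_ord.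
  by rewrite tw tl /D /= ltnn.
rewrite -H.
- congr (P _); apply/seteqP; split => w /=.
    move=> [Bw Cw] i _ /=; rewrite tw tl /D; case: ltnP => ik; first exact: Bw.
    by have -> : nat_of_ord i = k by apply/eqP; rewrite eqn_leq ik -ltnS ltn_ord.
  move=> H'; split => [i /= ik|].
    have := H' (Ordinal (ltnW ik : (i < k.+1)%N)) I.
    by rewrite /= tw tl /D /= ik.
  by have := H' ord_max I; rewrite /= tw tl /D /= ltnn.
- move=> i; rewrite tw tl ltr_pM2r// ltr_nat; case: (ltnP i k) => // ik.
  by rewrite (leq_ltn_trans _ kN)// -ltnS ltn_ord.
- by move=> i; rewrite /D; case: ifP.
Qed.

(** Dynkin's argument: for fixed [C], the events satisfying the product formula form a
    lambda-system, and it contains the pi-system of cylinders by the law of the increments. *)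
Lemma past_indep k N Q (C : set R) : (k < N)%N -> past k Q -> measurable C ->
  P (Q `&` [set w | C (walk N w - walk k w)]) =
  (P Q * normal_prob 0 (Num.sqrt ((N - k)%:R * h)) C)%E.
Proof.
move=> kN + mC.
set E := [set w | _]; set c := normal_prob _ _ _.
have cE : c = normal_prob 0 (Num.sqrt (N%:R * h - k%:R * h)) C.
  by rewrite /c (natrB _ (ltnW kN)) mulrBl.
have cfin : c \is a fin_num by exact: (fin_num_measure (@normal_prob R _ _)).
have mE : measurable E.
  rewrite -[X in measurable X]setTI.
  have : measurable_fun setT (fun w => walk N w - walk k w).
    by apply: measurable_funB; exact: measurable_walk.
  by move=> /(_ measurableT _ mC).
have Hcyl A : cylinder k A -> P (A `&` E) = (P A * c)%E.
  move=> [B mB ->]; rewrite /E (cylinder_prob kN mB mC).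
  (* A trivial last factor gives the probability of the cylinder itself. *)
  have := @cylinder_prob k N B setT kN mB measurableT.
  have -> : [set w | [set: R] (walk N w - walk k w)] = setT.
    by apply/seteqP; split.
  rewrite setIT => ->.
  have -> : normal_prob 0 (Num.sqrt (N%:R * h - k%:R * h)) setT = 1%E.
    exact: (@probability_setT _ _ _ (@normal_prob R _ _)).
  by rewrite mule1 -cE.
clear cE; clearbody c E.
suff : past k `<=` [set A | measurable A /\ P (A `&` E) = (P A * c)%E].
  by move=> /[apply] -[].
have HT : P (setT `&` E) = (P setT * c)%E.
  apply: Hcyl; exists (fun=> setT); first by move=> i; exact: measurableT.
  by apply/seteqP; split=> w _; [move=> i _; exact: I|exact: I].
apply: lambda_system_subset.
- exact: cylinder_setI.
- apply/dynkin_lambda_system; split=> [|A [mA HA]|F tF HF].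
  + by split; [exact: measurableT|exact: HT].
  + split; first exact: measurableC.
    have PAc : (P A * c)%E \is a fin_num by rewrite fin_numM// fin_num_measure.
    have H1 : (P (~` A `&` E) + P (A `&` E) = P E)%E.
      rewrite -measureU.
      * by rewrite -setIUl setUC setUv setTI.
      * by apply: measurableI => //; exact: measurableC.
      * exact: measurableI.
      * by rewrite setIACA setICl set0I.
    have H2 : (P (~` A) * c + P A * c = P E)%E.
      rewrite -muleDl//; last first.
        by rewrite fin_num_adde_defl// fin_num_measure.
      rewrite -measureU; first by rewrite setUC setUv -HT setTI.
      * exact: measurableC.
      * exact: mA.
      * by rewrite setICl.
    move: H1; rewrite -H2 HA => /(congr1 (fun z => z - P A * c)%E).
    by rewrite !addeK.
  + split; first by apply: bigcup_measurable => i _; case: (HF i).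
    rewrite setI_bigcupl !measure_bigcup.
    * rewrite -(fineK cfin) [RHS]muleC -nneseriesZl.
        apply: eq_eseriesr => i _.
        by apply: etrans (HF i).2 _; rewrite fineK// muleC.
      by move=> i _; exact: measure_ge0.
    * by move=> i _; case: (HF i).
    * exact: tF.
    * by move=> i _; apply: measurableI => //; case: (HF i).
    * exact: trivIset_setIr.
- by move=> A cA; split; [exact: cylinder_measurable cA|exact: Hcyl].
- by [].
Qed.

End walk.

(** * Real-valued probabilities, suited to linear arithmetic *)

Definition prob {d} {T : measurableType d} {R : realType} (P : probability T R)
  (A : set T) : R := fine (P A).

Section prob_theory.
Context {d : measure_display} {T : measurableType d} {R : realType}
  (P : probability T R).
Implicit Types A B : set T.

Lemma probE A : measurable A -> P A = (prob P A)%:E.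
Proof. by move=> mA; rewrite fineK// fin_num_measure. Qed.

Lemma prob_ge0 A : 0 <= prob P A.
Proof. by rewrite fine_ge0// measure_ge0. Qed.

Lemma le_prob A B : measurable A -> measurable B -> A `<=` B -> prob P A <= prob P B.
Proof.
by move=> mA mB AB; rewrite -lee_fin -!probE//; apply: le_measure => //; rewrite inE.
Qed.

Lemma probU A B : measurable A -> measurable B -> A `&` B = set0 ->
  prob P (A `|` B) = prob P A + prob P B.
Proof.
move=> mA mB AB; apply: EFin_inj.
by rewrite EFinD -!probE ?measureU//; exact: measurableU.
Qed.

Lemma probDI A B : measurable A -> measurable B ->
  prob P A = prob P (A `\` B) + prob P (A `&` B).
Proof.
move=> mA mB; rewrite -probU.
- by rewrite setUC setUIDK.
- exact: measurableD.
- exact: measurableI.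
- by rewrite -subset0 => x [[_ nB] [_ B']].
Qed.

Lemma probU_le A B : measurable A -> measurable B ->
  prob P (A `|` B) <= prob P A + prob P B.
Proof.
move=> mA mB; rewrite -lee_fin EFinD -!probE//; last exact: measurableU.
exact: measureU2.
Qed.

Lemma prob_set0 : prob P set0 = 0.
Proof. by rewrite /prob measure0. Qed.

Lemma prob_setT : prob P setT = 1.
Proof. by rewrite /prob probability_setT. Qed.

End prob_theory.

(** * A maximal inequality relative to the past *)

Section maximal.
Context {d : measure_display} {Omega : measurableType d} {R : realType}
  (P : probability Omega R) (W : R -> Omega -> R) (hW : is_standard_BM P W)
  (h : R) (h0 : 0 < h).
Local Notation walk := (walk W h).
Local Notation past := (past W h).
Local Notation pr := (prob P).

Lemma past_incr k j l : (k <= l)%N -> (j <= l)%N ->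
  measurable_fun setT (fun w : g_sigma_algebraType (cylinder W h l) => walk j w - walk k w).
Proof. by move=> kl jl; apply: measurable_funB; exact: (past_walk hW). Qed.

Lemma past_incr_ge k j l (c : R) : (k <= l)%N -> (j <= l)%N ->
  past l [set w | c <= `|walk j w - walk k w|].
Proof.
move=> kl jl.
exact: (past_pre (past_incr kl jl) (measurable_norm_ge c)).
Qed.

Lemma prob_past_incr k N Q (C : set R) : (k < N)%N -> past k Q -> measurable C ->
  pr (Q `&` [set w | C (walk N w - walk k w)]) =
  pr Q * fine (normal_prob 0 (Num.sqrt ((N - k)%:R * h)) C).
Proof.
move=> kN pQ mC; rewrite /prob (past_indep hW h0 kN pQ mC) fineM//.
  by rewrite fin_num_measure//; exact: (past_measurable hW pQ).
exact: (fin_num_measure (@normal_prob R _ _)).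
Qed.

(** The factor [pr Q] is kept so that the bound can be applied to each first-hit event and
    summed. *)
Lemma prob_past_incr_ge k N Q (c : R) : (k < N)%N -> past k Q -> 0 < c ->
  pr (Q `&` [set w | c <= `|walk N w - walk k w|]) <=
  pr Q * (4 * ((N - k)%:R * h) / c ^+ 2).
Proof.
move=> kN pQ c0.
rewrite (prob_past_incr kN pQ (measurable_norm_ge c)) ler_wpM2l ?prob_ge0//.
have nh : 0 < (N - k)%:R * h by rewrite mulr_gt0// ltr0n subn_gt0.
rewrite -lee_fin fineK; last first.
  exact: (fin_num_measure (@normal_prob R _ _) _ (measurable_norm_ge c)).
have := @normal_prob_norm_ge _ (Num.sqrt ((N - k)%:R * h)) c.
by rewrite sqrtr_gt0 sqr_sqrtr ?(ltW nh)//; exact.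
Qed.

(* Only the indices [i < j] are inspected. *)
Definition hit k j (l : R) : set Omega :=
  \bigcup_(i in `I_j) [set w | l <= `|walk (k + i) w - walk k w|].

Lemma past_hit k j m l : (j <= m.+1)%N -> past (k + m) (hit k j l).
Proof.
move=> jm; apply: past_bigcup => i /= ij; apply: past_incr_ge.
  exact: leq_addr.
by rewrite leq_add2l -ltnS (leq_trans ij).
Qed.

Lemma hitS k j l :
  hit k j.+1 l = hit k j l `|` [set w | l <= `|walk (k + j) w - walk k w|].
Proof.
apply/seteqP; split => w.
  move=> [i /=]; rewrite ltnS leq_eqVlt => /orP[/eqP -> ?|ij ?]; first by right.
  by left; exists i.
by move=> [[i /= ij ?]|?]; [exists i => //=; exact: ltnW|exists j => //=].
Qed.

(* Ottaviani's inequality, relative to a past event [Q]: at the first index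
   where the increment reaches [l], the remaining increment stays below [l / 2]
   with probability at least 1/2. When this fails, the right-hand side already
   exceeds [prob P Q]. *)
Lemma prob_hit_le k N Q (l : R) : past k Q -> 0 < l ->
  pr (Q `&` hit k N.+1 l) <= 32 * (N%:R * h) / l ^+ 2 * pr Q.
Proof.
move=> pQ l0.
have mp m A : past m A -> measurable A by exact: (past_measurable hW).
have mQ := mp _ _ pQ.
have mhit j : measurable (hit k j l).
  by apply: (mp (k + j)%N); apply: past_hit; exact: leqnSn.
have bnd_ge0 : 0 <= 16 * (N%:R * h) / l ^+ 2.
  by rewrite divr_ge0 ?exprn_ge0 ?mulr_ge0// ?ltW.
have E32 : 32 * (N%:R * h) / l ^+ 2 = 2 * (16 * (N%:R * h) / l ^+ 2) by field; lra.
(* Independence is available for a strictly later index only, so [N = 0] is separate: the sole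
   inspected increment is then 0. *)
have [N0|N0] := posnP N.
  rewrite N0 !mul0r mulr0 !mul0r (_ : _ `&` _ = set0) ?prob_set0//.
  rewrite -subset0 => w [_ [i /=]]; rewrite ltnS leqn0 => /eqP ->.
  by rewrite addn0 subrr normr0 leNgt l0.
(* The tail bound at threshold [l / 2] reads $16Nh/l^2$. It must be at most 1/2 for the argument,
   and the announced bound is twice it. *)
have [big|small] := ltP 2^-1 (16 * (N%:R * h) / l ^+ 2).
  apply: (@le_trans _ _ (pr Q)).
    by apply: le_prob => //; exact: measurableI.
  by rewrite ler_peMl ?prob_ge0// E32; lra.
set E := [set w | l / 2 <= `|walk (k + N) w - walk k w|].
have pE : past (k + N) E by apply: past_incr_ge => //; exact: leq_addr.
have mE := mp _ _ pE.
have l20 : 0 < l / 2 by rewrite divr_gt0.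
(* Induction on the first hitting index: the event [A] below is a first hit at [j] exactly, and the
   inequality is summed over these disjoint events. *)
have key j : (j <= N.+1)%N ->
    pr (Q `&` hit k j l) <= 2 * pr (Q `&` hit k j l `&` E).
  elim: j => [_|j IH jN].
    rewrite (_ : hit _ _ _ = set0) ?setI0 ?set0I ?prob_set0 ?mulr0//.
    by rewrite -subset0 => w [].
  have {}IH := IH (ltnW jN).
  pose A := Q `&` [set w | l <= `|walk (k + j) w - walk k w|] `\` hit k j l.
  have pA : past (k + j) A.
    rewrite /A setDE; apply: pastI; last first.
      rewrite -setTD; apply: (@measurableD _ (g_sigma_algebraType (cylinder W h (k + j)))).
        exact: measurableT.
      exact: past_hit.
    apply: pastI; first by apply: past_le pQ; exact: leq_addr.
    by apply: past_incr_ge => //; exact: leq_addr.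
  have mA := mp _ _ pA.
  have dec : Q `&` hit k j.+1 l = (Q `&` hit k j l) `|` A.
    rewrite hitS setIUr /A; apply/seteqP; split => w.
      move=> [?|[Qw lw]]; first by left.
      by have [?|?] := pselect (hit k j l w); [left|right].
    by move=> [?|[? _]]; [left|right].
  have disj : (Q `&` hit k j l) `&` A = set0.
    by rewrite -subset0 => w [[_ ?] [_]].
  have mQh : measurable (Q `&` hit k j l) by exact: measurableI.
  have HA : pr A <= 2 * pr (A `&` E).
    move: jN; rewrite ltnS leq_eqVlt => /orP[/eqP jN|jN].
      have -> : A `&` E = A; last by have := prob_ge0 P A; lra.
      apply/setIidPl => w [[_ /=]]; rewrite /E /= jN => + _; lra.
    have kjN : (k + j < k + N)%N by rewrite ltn_add2l.
    have := prob_past_incr_ge kjN pA l20.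
    set D := [set w | _] => HD.
    have mD : measurable D.
      apply: (mp (k + N)%N); apply: past_incr_ge => //.
      by rewrite leq_add2l ltnW.
    (* If the increment from [j] to [N] stays below [l / 2], a value of size at least [l] at [j]
       leaves at least [l / 2] at [N]. *)
    have /(le_prob P) : A `\` D `<=` A `&` E.
      move=> w [Aw nD]; split => //; move: Aw nD => [[_ /=]] + _.
      rewrite /D /E /= => lj /negP; rewrite -ltNge => lN.
      have := ler_normB (walk (k + N) w - walk k w) (walk (k + N) w - walk (k + j) w).
      have -> : walk (k + N) w - walk k w - (walk (k + N) w - walk (k + j) w) =
         walk (k + j) w - walk k w by ring.
      lra.
    have mAD : measurable (A `\` D) by exact: measurableD.
    have mAE : measurable (A `&` E) by exact: measurableI.
    move=> /(_ mAD mAE); have := probDI P mA mD.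
    suff : pr A * (4 * ((k + N - (k + j))%:R * h) / (l / 2) ^+ 2) <= pr A / 2.
      by move: HD; lra.
    rewrite ler_wpM2l ?prob_ge0//; apply: le_trans small.
    have -> : 4 * ((k + N - (k + j))%:R * h) / (l / 2) ^+ 2 =
      16 * ((N - j)%:R * h) / l ^+ 2 by rewrite subnDl; field; lra.
    rewrite ler_pM2r ?invr_gt0 ?exprn_gt0// ler_pM2l// ler_pM2r// ler_nat.
    exact: leq_subr.
  have mQhE : measurable (Q `&` hit k j l `&` E) by exact: measurableI.
  have mAE : measurable (A `&` E) by exact: measurableI.
  rewrite dec setIUl !probU//; first lra.
  by rewrite setIACA setIid disj set0I.
apply: le_trans (key N.+1 (leqnn _)) _.
have kN : (k < k + N)%N by rewrite -{1}(addn0 k) ltn_add2l.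
have := prob_past_incr_ge kN pQ l20; rewrite -/E addKn => HE.
have : pr (Q `&` hit k N.+1 l `&` E) <= pr (Q `&` E).
  apply: le_prob; [|exact: measurableI|by move=> w [[? _] ?]].
  by apply: measurableI => //; exact: measurableI.
have -> : 32 * (N%:R * h) / l ^+ 2 * pr Q =
  2 * (pr Q * (4 * (N%:R * h) / (l / 2) ^+ 2)) by field; lra.
lra.
Qed.

End maximal.

Lemma measurable_norm_lt {R : realType} (e : R) : measurable [set x : R | `|x| < e].
Proof.
rewrite (_ : [set x | _] = ~` [set x : R | e <= `|x|]).
  by apply: measurableC; exact: measurable_norm_ge.
by apply/seteqP; split => x /=; rewrite ltNge => /negP.
Qed.

Lemma measurable_norm_le {R : realType} (e : R) : measurable [set x : R | `|x| <= e].
Proof.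
rewrite (_ : [set x | _] = `[- e, e]%classic)//.
by apply/seteqP; split => x /=; rewrite in_itv/= ler_norml.
Qed.

(** * Small balls and dyadic scales on the grid *)

Section grid.
Context {d : measure_display} {Omega : measurableType d} {R : realType}
  (P : probability Omega R) (W : R -> Omega -> R) (hW : is_standard_BM P W)
  (h : R) (h0 : 0 < h).
Local Notation walk := (walk W h).
Local Notation past := (past W h).
Local Notation hit := (hit W h).
Local Notation pr := (prob P).

Lemma past_mem j k (B : set R) : (j <= k)%N -> measurable B ->
  past k [set w | B (walk j w)].
Proof. by move=> jk; exact: (past_pre (past_walk hW jk)). Qed.

Let mp k A (pA : past k A) : measurable A := past_measurable hW pA.

(** The increment falls in [C] with probability at least 1/2, and the maximal inequality at level
    [e / 2] removes at most 1/4; this fixes $512 = 32\cdot 4\cdot 4$. *)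
Lemma prob_step_ge k r (e : R) Q (C : set R) : (0 < r)%N -> 0 < e ->
  512 * (r%:R * h) <= e ^+ 2 -> past k Q -> measurable C ->
  (2^-1%:E <= normal_prob 0 (Num.sqrt (r%:R * h)) C)%E ->
  pr Q / 4 <=
  pr ((Q `&` [set w | C (walk (k + r) w - walk k w)]) `\` hit k r.+1 (e / 2)).
Proof.
move=> r0 e0 rh pQ mC HC.
have kr : (k < k + r)%N by rewrite -{1}(addn0 k) ltn_add2l.
have pE : past (k + r) (Q `&` [set w | C (walk (k + r) w - walk k w)]).
  apply: pastI; first by apply: past_le pQ; exact: leq_addr.
  exact: (past_pre (past_incr hW (leq_addr _ _) (leqnn _)) mC).
have mE := mp pE.
have mH : measurable (hit k r.+1 (e / 2)).
  by apply: (@mp (k + r)); exact: (past_hit hW).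
have mQ := mp pQ.
have e20 : 0 < e / 2 by rewrite divr_gt0.
have H1 := prob_hit_le hW h0 r pQ e20.
have H2 := probDI P mE mH.
have H3 : pr (Q `&` [set w | C (walk (k + r) w - walk k w)] `&` hit k r.+1 (e / 2))
    <= pr (Q `&` hit k r.+1 (e / 2)).
  apply: le_prob; [exact: measurableI|exact: measurableI|].
  by move=> w [[? _] ?].
have H4 := prob_past_incr hW h0 kr pQ mC; rewrite addKn in H4.
have H5 : 2^-1 <= fine (normal_prob 0 (Num.sqrt (r%:R * h)) C).
  by rewrite -lee_fin fineK//; exact: (fin_num_measure (@normal_prob R _ _) _ mC).
have H6 : 32 * (r%:R * h) / (e / 2) ^+ 2 <= 4^-1.
  rewrite ler_pdivrMr ?exprn_gt0//; move: rh; rewrite expr_div_n; lra.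
have Q0 := prob_ge0 P Q.
have := ler_wpM2l Q0 H5; have := ler_wpM2r Q0 H6.
rewrite -H4; lra.
Qed.

Definition band (n : nat) (e : R) : set Omega :=
  \bigcap_(i in `I_n.+1) [set w | `|walk i w| < e].

Lemma past_ball n e :
  past n (band n e `&` [set w | `|walk n w| <= e / 2]).
Proof.
apply: pastI; last exact: (past_mem (leqnn n) (measurable_norm_le (e / 2))).
apply: past_bigcap => i /=; rewrite ltnS => ni.
exact: (past_mem ni (measurable_norm_lt e)).
Qed.

(* Each block of [r] steps is survived with probability at least 1/4 by asking
   the block increment to have the sign opposite to the current position. *)
Lemma small_ball_prob r (e : R) M : (0 < r)%N -> 0 < e ->
  512 * (r%:R * h) <= e ^+ 2 ->
  4^-1 ^+ M <= pr (band (M * r) e `&` [set w | `|walk (M * r) w| <= e / 2]).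
Proof.
move=> r0 e0 rh; have rh0 : 0 < Num.sqrt (r%:R * h).
  by rewrite sqrtr_gt0 mulr_gt0// ltr0n.
elim: M => [|M IH].
  rewrite expr0 mul0n (_ : _ `&` _ = setT) ?prob_setT//.
  apply/seteqP; split => // w _; split => [i /=|/=].
    by rewrite ltnS leqn0 => /eqP ->; rewrite (walk0 hW) normr0.
  by rewrite (walk0 hW) normr0 divr_ge0 ?ltW.
set Q := _ `&` _ in IH.
have pQ : past (M * r) Q by exact: past_ball.
have mQ := mp pQ.
(* Splitting on the sign of the endpoint loses nothing: the two disjoint contributions add up to at
   least [pr Q / 4]. *)
pose B := [set w | `[0%R, +oo[%classic (walk (M * r) w)].
have pB : past (M * r) B by exact: (past_mem (leqnn _) (measurable_itv _)).
have pBC : past (M * r) (~` B).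
  rewrite -setTD; apply: (@measurableD _ (g_sigma_algebraType (cylinder W h (M * r)))).
    exact: measurableT.
  exact: pB.
have [half1 half2] := normal_prob_half rh0.
have S1 := prob_step_ge r0 e0 rh (pastI pQ pB) (measurable_itv _) half2.
have S2 := prob_step_ge r0 e0 rh (pastI pQ pBC) (measurable_itv _) half1.
move: S1 S2; set A1 := _ `\` _; set A2 := _ `\` _ => S1 S2.
have pA (A : set Omega) (C : set R) : past (M * r) A -> measurable C ->
   past (M * r + r) ((A `&` [set w | C (walk (M * r + r) w - walk (M * r) w)]) `\`
     hit (M * r) r.+1 (e / 2)).
  move=> pA mC; rewrite setDE; apply: pastI.
    apply: pastI; first by apply: past_le pA; exact: leq_addr.
    exact: (past_pre (past_incr hW (leq_addr _ _) (leqnn _)) mC).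
  rewrite -setTD; apply: (@measurableD _ (g_sigma_algebraType (cylinder W h (M * r + r)))).
    exact: measurableT.
  exact: (past_hit hW).
have mA1 := mp (pA _ _ (pastI pQ pB) (measurable_itv `]-oo, 0%R])).
have mA2 := mp (pA _ _ (pastI pQ pBC) (measurable_itv `[0%R, +oo[)).
have D12 : A1 `&` A2 = set0.
  by rewrite -subset0 => w [[[[_ ?] _] _] [[[_ ?] _] _]].
have := probU P mA1 mA2 D12.
have : pr (A1 `|` A2) <=
    pr (band (M.+1 * r) e `&` [set w | `|walk (M.+1 * r) w| <= e / 2]).
  apply: le_prob; [exact: measurableU|apply: (@mp (M.+1 * r)); exact: past_ball|].
  have sub w : Q w -> ~ hit (M * r) r.+1 (e / 2) w ->
     `|walk (M * r + r) w| <= e / 2 ->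
     (band (M.+1 * r) e `&` [set w | `|walk (M.+1 * r) w| <= e / 2]) w.
    move=> [Qb /= Qe] nh He; rewrite mulSn addnC; split => // i /= iM.
    have [?|Mi] := leqP i (M * r); first exact: Qb.
    have {}nh : `|walk (M * r + (i - M * r)) w - walk (M * r) w| < e / 2.
      rewrite ltNge; apply/negP => H; apply: nh; exists (i - M * r)%N => //=.
      by rewrite ltnS leq_subLR -ltnS.
    rewrite subnKC ?(ltnW Mi)// in nh.
    have := ler_normD (walk i w - walk (M * r) w) (walk (M * r) w).
    rewrite subrK; lra.
  (* [hit] with bound [r.+1] also inspects index [r], the full block increment. *)
  have last w : ~ hit (M * r) r.+1 (e / 2) w ->
      `|walk (M * r + r) w - walk (M * r) w| < e / 2.
    move=> nh; rewrite ltNge; apply/negP => H; apply: nh; exists r => //=.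
  (* A position in $[0,e/2]$ plus an increment in $(-e/2,0]$ is again within $e/2$, so the inner
     ball is recovered; the other case is symmetric. *)
  move=> w [[[[Qw Bw] Cw] nh]|[[[Qw Bw] Cw] nh]]; apply: sub => //.
    have := last _ nh; move: Bw Cw Qw; rewrite /B /setC /= !in_itv/= andbT => Bw Cw [_ /=].
    rewrite ltr_norml !ler_norml => /andP[Q1 Q2] /andP[N1 N2].
    apply/andP; split; lra.
  have := last _ nh; move: Bw Cw Qw; rewrite /B /setC /= !in_itv/= !andbT => /negP.
  rewrite -ltNge => Bw Cw [_ /=].
  rewrite ltr_norml !ler_norml => /andP[Q1 Q2] /andP[N1 N2].
  apply/andP; split; lra.
have HQ : pr Q = pr (Q `&` ~` B) + pr (Q `&` B).
  by rewrite -setDE; apply: probDI => //; exact: (mp pB).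
rewrite exprS; move: S1 S2 HQ IH; lra.
Qed.

(* [(1 - rho) / 2 * rho ^+ n] sums to 1/2 over all [n]. *)
Lemma prob_avoid_ge K Q (lam : nat -> R) (rho : R) J : past K Q ->
  (forall n, 0 < lam n) ->
  (forall n, 32 * ((2 ^ n * K)%:R * h) / lam n ^+ 2 <= (1 - rho) / 2 * rho ^+ n) ->
  pr Q * ((1 + rho ^+ J) / 2) <=
  pr (Q `\` \bigcup_(n in `I_J) hit K (2 ^ n * K).+1 (lam n)).
Proof.
move=> pQ lam0 Hlam; have mQ := mp pQ.
have mH n : measurable (hit K (2 ^ n * K).+1 (lam n)).
  by apply: (@mp (K + 2 ^ n * K)); exact: (past_hit hW).
have mU j : measurable (\bigcup_(n in `I_j) hit K (2 ^ n * K).+1 (lam n)).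
  by apply: bigcup_measurable => n _.
(* The factor $(1+\rho^J)/2$ is 1 minus the first [J] terms of the series, which makes the bound
   inductive. *)
elim: J => [|J IH].
  rewrite expr0 (_ : \bigcup_(n in _) _ = set0).
    by rewrite setD0; lra.
  by rewrite -subset0 => w [].
set U := \bigcup_(n in `I_J.+1) _.
set V := \bigcup_(n in `I_J) _ in IH.
have UV : Q `\` V `<=` (Q `\` U) `|` (Q `&` hit K (2 ^ J * K).+1 (lam J)).
  move=> w [Qw nV]; have [Hw|nH] := pselect (hit K (2 ^ J * K).+1 (lam J) w).
    by right.
  left; split => // -[n /=]; rewrite ltnS leq_eqVlt => /orP[/eqP ->//|nJ] Hn.
  by apply: nV; exists n.
have H1 : pr (Q `\` V) <= pr ((Q `\` U) `|` (Q `&` hit K (2 ^ J * K).+1 (lam J))).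
  apply: le_prob => //; first exact: (measurableD mQ (mU J)).
  by apply: measurableU; [exact: (measurableD mQ (mU J.+1))|exact: measurableI].
have H2 := probU_le P (measurableD mQ (mU J.+1)) (measurableI _ _ mQ (mH J)).
have H3 := prob_hit_le hW h0 (2 ^ J * K) pQ (lam0 J).
have := ler_wpM2r (prob_ge0 P Q) (Hlam J).
rewrite (exprS rho J); move: H1 H2 H3 IH; rewrite -/U; lra.
Qed.

End grid.

(** * Survival with positive probability *)

Section real_estimates.
Context {R : realType}.
Implicit Types (kappa a u v : R).

Lemma ler_powR_base (p u v : R) : 0 <= p -> 0 <= u -> u <= v ->
  u `^ p <= v `^ p.
Proof.
move=> p0 u0 uv; apply: ge0_ler_powR; rewrite ?nnegrE//.
exact: le_trans u0 uv.
Qed.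

Lemma powR_large (p C : R) : 0 < p -> exists v0 : R, 0 < v0 /\
  forall v, v0 <= v -> C <= v `^ p.
Proof.
move=> p0; pose c := Num.max C 1.
have c0 : 0 < c by rewrite lt_max ltr01 orbT.
exists (c `^ p^-1); split => [|v hv]; first exact: powR_gt0.
apply: (@le_trans _ _ c); first by rewrite le_max lexx.
have -> : c = (c `^ p^-1) `^ p.
  by rewrite -powRrM mulVf ?gt_eqF// powRr1// ltW.
exact: ler_powR_base (ltW p0) (powR_ge0 _ _) hv.
Qed.

Lemma powR_two_ratio kappa : 1 / 2 < kappa -> 0 < (2 : R) `^ (1 - 2 * kappa) < 1.
Proof.
move=> hk; rewrite powR_gt0//= /powR pnatr_eq0/= -[ltRHS]expR0 ltr_expR.
have l2 : 0 < ln (2 : R) by rewrite ln_gt0// ltr1n.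
nra.
Qed.

(* Maximal-inequality bound at time scale [u = 2^n v] with threshold [u^kappa / 2]:
   it is geometric in [n], with ratio [2^(1 - 2 kappa) < 1]. *)
Lemma scaled_variance kappa v n : 0 < v ->
  32 * (2 * (2 ^+ n * v)) / ((2 ^+ n * v) `^ kappa / 2) ^+ 2 =
  256 * v `^ (1 - 2 * kappa) * (2 `^ (1 - 2 * kappa)) ^+ n.
Proof.
move=> v0; set u := 2 ^+ n * v.
have u0 : 0 < u by rewrite mulr_gt0 ?exprn_gt0.
have -> : 256 * v `^ (1 - 2 * kappa) * (2 `^ (1 - 2 * kappa)) ^+ n =
    256 * u `^ (1 - 2 * kappa).
  rewrite /u powRM ?exprn_ge0 ?(ltW v0)// -powR_mulrn// -powR_mulrn ?powR_ge0//.
  by rewrite -!powRrM (mulrC n%:R); ring.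
rewrite powRB; last by rewrite (negbT (gt_eqF u0)) implybT.
rewrite (mulrC 2 kappa) powRrM powRr1 ?ltW// powR_mulrn ?powR_ge0//.
by field; rewrite gt_eqF// powR_gt0.
Qed.

(** The second clause lets half of the boundary absorb the starting height, the other half being the
    threshold for later increments; the third bounds the first term of the geometric series. *)
Lemma large_time kappa a : 1 / 2 < kappa -> 0 < a ->
  exists v0 : R, forall v, v0 <= v ->
    [/\ 0 < v, 2 * a `^ kappa <= v `^ kappa &
      256 * v `^ (1 - 2 * kappa) <= (1 - 2 `^ (1 - 2 * kappa)) / 2].
Proof.
move=> hk a0; have /andP[r0 r1] := powR_two_ratio hk.
set rho := 2 `^ _ in r0 r1 *.
have k1 : 0 < 2 * kappa - 1 by lra.
have [v1 [v10 Hv1]] := powR_large (512 / (1 - rho)) k1.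
(* [4 * a] serves the second clause, as $4^\kappa\ge 2$, and [v1] the third. *)
exists (4 * a + v1) => v hv.
have v0 : 0 < v by lra.
split => //.
  apply: (@le_trans _ _ ((4 * a) `^ kappa)).
    rewrite powRM ?(ltW a0)// ler_pM2r ?powR_gt0//.
    have -> : (4 : R) = 2 `^ 2%:R by rewrite powR_mulrn//; ring.
    rewrite -powRrM -[leLHS]powRr1// ler_powR ?ler1n//; lra.
  by apply: ge0_ler_powR; rewrite ?nnegrE; lra.
have -> : 1 - 2 * kappa = - (2 * kappa - 1) by ring.
have v1v : v1 <= v by lra.
rewrite powRN ler_pdivrMr ?powR_gt0//.
have := Hv1 v v1v; rewrite ler_pdivrMr ?subr_gt0//; lra.
Qed.

(** Take the least admissible [n]. If [n > 0], minimality gives $2^{n-1}K<j$; if [n = 0], the last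
    bound is clear. *)
Lemma dyadic_block (K j J : nat) : (0 < j <= 2 ^ J * K)%N ->
  exists n, [/\ (n <= J)%N, (j <= 2 ^ n * K)%N & (2 ^ n * K < 2 * (K + j))%N].
Proof.
move=> /andP[j0 jJ].
have ex : exists n, (j <= 2 ^ n * K)%N by exists J.
case: (ex_minnP ex) => n jn nmin; exists n; split => //; first exact: nmin.
case: n jn nmin => [|n] jn nmin; first by rewrite expn0; lia.
rewrite ltnNge; apply/negP => H.
have := nmin n; rewrite expnS in H; lia.
Qed.

(** Approximation is from below, so that the grid point stays in the time range and under an
    increasing boundary. *)
Lemma dyadic_below (delta eta u : R) : 0 < delta -> 0 < eta -> 0 <= u ->
  exists m i : nat, i%:R * (delta / (2 ^ m)%:R) <= u /\
    u - i%:R * (delta / (2 ^ m)%:R) < eta.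
Proof.
move=> d0 e0 u0; pose m := Num.bound (delta / eta).
have Hm : delta / eta < 2 ^+ m by exact: upper_nthrootP.
have m0 : 0 < (2 ^ m)%:R :> R by rewrite ltr0n expn_gt0.
pose h := delta / (2 ^ m)%:R; have h0 : 0 < h by rewrite divr_gt0.
exists m, (Num.trunc (u / h)).
have /andP[] := trunc_itv (divr_ge0 u0 (ltW h0)).
rewrite ler_pdivlMr// ltr_pdivrMr// -/h => H1 H2; split => //.
have : h < eta by rewrite ltr_pdivrMr// natrX mulrC -ltr_pdivrMr.
move: H2; rewrite -natr1; lra.
Qed.

End real_estimates.

(** * From the grid to the continuous path *)

Section survival.
Context {d : measure_display} {Omega : measurableType d} {R : realType}
  (P : probability Omega R) (W : R -> Omega -> R) (hW : is_standard_BM P W).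
Local Notation pr := (prob P).
Implicit Types (kappa a e y u v : R).

(** The order of quantifiers is the point: [c] is fixed before the mesh [r], the horizon [J] and the
    start [y]. The margin [e / 2] is reserved for the passage to continuous time. *)
Lemma grid_survival kappa a e : 1 / 2 < kappa -> 0 < a -> 0 < e ->
  exists delta : R, exists M : nat, exists c : R,
  [/\ 0 < delta, (0 < M)%N, 0 < c & forall r J y, (0 < r)%N ->
    `|y| + 2 * e <= a `^ kappa ->
    c <= pr (\bigcap_(i in `I_(2 ^ J * (M * r)).+1)
      [set w | `|y + walk W (delta / r%:R) i w| <=
               (a + i%:R * (delta / r%:R)) `^ kappa - e / 2])].
Proof.
move=> hk a0 e0; have [v0 Hv] := large_time hk a0.
have k0 : 0 <= kappa by lra.
pose delta := e ^+ 2 / 512.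
have d0 : 0 < delta by apply: divr_gt0; [rewrite exprn_gt0|rewrite ltr0n].
have [M M0 HM] : exists2 M : nat, (0 < M)%N & v0 <= M%:R * delta / 2.
  exists (Num.trunc (2 * v0 / delta)).+1 => //.
  have := truncnS_gt (2 * v0 / delta); rewrite ltr_pdivrMr//; lra.
(* [4^-1 ^+ M] pays for the small ball, 1/2 for all later scales. *)
exists delta, M, (4^-1 ^+ M / 2); split => //.
move=> r J y r0 hy; set h := delta / r%:R.
have rpos : 0 < r%:R :> R by rewrite ltr0n.
have h0 : 0 < h by rewrite divr_gt0.
have rh : r%:R * h = delta by rewrite /h; field; rewrite gt_eqF.
set K := (M * r)%N.
(* [v] is half the confinement time: [dyadic_block] gives [2 ^ n * K < 2 * i], hence $2^n v\le
   ih$. *)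
pose v := M%:R * delta / 2; have [vpos va vsmall] := Hv v HM.
have Kh : K%:R * h = 2 * v by rewrite /K natrM -mulrA rh /v; field.
pose lam (n : nat) := (2 ^+ n * v) `^ kappa / 2.
have lam0 n : 0 < lam n by rewrite divr_gt0// powR_gt0// mulr_gt0// exprn_gt0.
have rho01 := powR_two_ratio hk; move: (rho01) => /andP[rho0 rho1].
have Hlam n : 32 * ((2 ^ n * K)%:R * h) / lam n ^+ 2 <=
    (1 - 2 `^ (1 - 2 * kappa)) / 2 * (2 `^ (1 - 2 * kappa)) ^+ n.
  have -> : (2 ^ n * K)%:R * h = 2 * (2 ^+ n * v).
    by rewrite natrM natrX -mulrA Kh; ring.
  by rewrite /lam scaled_variance// ler_wpM2r// exprn_ge0// ltW.
have rh' : 512 * (r%:R * h) <= e ^+ 2 by rewrite rh /delta; lra.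
have B1 := small_ball_prob hW h0 M r0 e0 rh'.
set Q := band _ _ _ _ `&` _ in B1.
have pQ : past W h K Q by exact: past_ball hW h K e.
have := prob_avoid_ge hW h0 J.+1 pQ lam0 Hlam.
set U := \bigcup_(n in _) _ => HU.
have le1 : 4^-1 ^+ M / 2 <= pr (Q `\` U).
  apply: le_trans HU.
  have X0 : 0 <= (2 `^ (1 - 2 * kappa)) ^+ J.+1 :> R by rewrite exprn_ge0// ltW.
  have := mulr_ge0 (prob_ge0 P Q) X0; lra.
apply: (le_trans le1).
have mU : measurable U.
  apply: bigcup_measurable => n _; apply: (past_measurable hW (k := K + 2 ^ n * K)).
  exact: (past_hit hW).
have mW i : measurable_fun setT (walk W h i) by exact: measurable_walk hW h i.
apply: le_prob.
- by apply: measurableD; [exact: (past_measurable hW pQ)|exact: mU].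
- apply: bigcap_measurableType => i _.
  have mf : measurable_fun setT (fun w => y + walk W h i w) by exact: measurable_funD.
  have := mf measurableT _ (measurable_norm_le ((a + i%:R * h) `^ kappa - e / 2)).
  by rewrite setTI.
move=> w [[Qb /= Qe] nU] i /=; rewrite ltnS => iJ.
have ih0 : 0 <= i%:R * h by rewrite mulr_ge0// ltW.
have [iK|Ki] := leqP i K.
  have := Qb i; rewrite /= ltnS => /(_ iK) Hi.
  have := ler_normD y (walk W h i w).
  have : a `^ kappa <= (a + i%:R * h) `^ kappa.
    by apply: ler_powR_base => //; [exact: ltW|rewrite lerDl].
  lra.
have [n [nJ jn Kn]] : exists n, [/\ (n <= J)%N, (i - K <= 2 ^ n * K)%N &
    (2 ^ n * K < 2 * (K + (i - K)))%N].
  by apply: dyadic_block; rewrite subn_gt0 Ki/= (leq_trans (leq_subr _ _)).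
rewrite subnKC ?(ltnW Ki)// in Kn.
have Hn : `|walk W h i w - walk W h K w| < lam n.
  rewrite ltNge; apply/negP => H; apply: nU; exists n => //=.
  exists (i - K)%N => //=.
  by rewrite subnKC ?(ltnW Ki).
have vn : 2 ^+ n * v <= a + i%:R * h.
  have : (2 ^ n * K)%:R * h <= (2 * i)%:R * h by rewrite ler_pM2r// ler_nat ltnW.
  have -> : (2 ^ n * K)%:R * h = 2 * (2 ^+ n * v).
    by rewrite natrM natrX -mulrA Kh; ring.
  rewrite natrM -mulrA; lra.
have vn0 : 0 <= 2 ^+ n * v by rewrite mulr_ge0 ?exprn_ge0// ltW.
have Hvn : (2 ^+ n * v) `^ kappa <= (a + i%:R * h) `^ kappa.
  exact: ler_powR_base.
have Hva : v `^ kappa <= (2 ^+ n * v) `^ kappa.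
  apply: ler_powR_base => //; first exact: ltW.
  by rewrite ler_peMl ?(ltW vpos)// exprn_ege1// ler1n.
(* The three contributions are $a^\kappa-2e$, $e/2$ and $(2^nv)^\kappa/2$; since
   $a^\kappa\le(2^nv)^\kappa/2$, they total at most $(2^nv)^\kappa-3e/2$. *)
have := ler_normD y (walk W h i w).
have := ler_normD (walk W h i w - walk W h K w) (walk W h K w).
rewrite subrK; move: Hn Qe; rewrite /lam; lra.
Qed.

Lemma path_continuous w u e : 0 <= u -> 0 < e ->
  exists2 eta : R, 0 < eta &
    forall v, 0 <= v -> `|u - v| < eta -> `|W u w - W v w| < e.
Proof.
move=> u0 e0; case: hW => _ /(_ w) /subspace_continuousP cW _ _.
have /cvgrPdist_lt /(_ e e0) := cW u u0.
rewrite near_withinE => /nbhs_ballP[eta /= eta0 H].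
by exists eta => // v v0 uv; exact: H.
Qed.

(** Events on successively halved meshes decrease, so their intersection keeps probability at least
    [c]; continuity then costs less than the margin [e / 2] between grid points. *)
Lemma path_survival kappa a e : 1 / 2 < kappa -> 0 < a -> 0 < e ->
  exists2 c : R, 0 < c & forall V y, `|y| + 2 * e <= a `^ kappa ->
    exists A : set Omega, [/\ measurable A, c <= pr A &
      forall w u, A w -> 0 <= u <= V -> `|y + W u w| < (a + u) `^ kappa].
Proof.
move=> hk a0 e0; have [delta [M [c [d0 M0 c0 H]]]] := grid_survival hk a0 e0.
exists c => // V y hy.
have [J HJ] : exists J : nat, V <= (2 ^ J * M)%:R * delta.
  exists (Num.bound (V / delta)); rewrite natrM natrX -ler_pdivrMr//.
  apply: le_trans (ltW (upper_nthrootP (leqnn _))) _.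
  by rewrite ler_peMr ?exprn_ge0// ler1n.
pose F m := \bigcap_(i in `I_(2 ^ J * (M * 2 ^ m)).+1)
      [set w | `|y + walk W (delta / (2 ^ m)%:R) i w| <=
               (a + i%:R * (delta / (2 ^ m)%:R)) `^ kappa - e / 2].
have mF m : measurable (F m).
  apply: bigcap_measurableType => i _.
  have mf : measurable_fun setT (fun w => y + walk W (delta / (2 ^ m)%:R) i w).
    by apply: measurable_funD => //; exact: measurable_walk hW _ i.
  have := mf measurableT _ (measurable_norm_le
    ((a + i%:R * (delta / (2 ^ m)%:R)) `^ kappa - e / 2)).
  by rewrite setTI.
have mFI : measurable (\bigcap_m F m) by exact: bigcap_measurableType.
exists (\bigcap_m F m); split => //.
  have Fdec : {homo F : n m / (n <= m)%N >-> (m <= n)%O}.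
    apply/nonincreasing_seqP => m; apply/subsetPset => w Fw i /= iJ.
    have := Fw (2 * i)%N; rewrite /= /walk.
    (* The point [i] of one mesh is the point [2 * i] of the next. *)
    have -> : (2 * i)%:R * (delta / (2 ^ m.+1)%:R) = i%:R * (delta / (2 ^ m)%:R) :> R.
      rewrite expnS !natrM; field.
      by rewrite pnatr_eq0 -lt0n expn_gt0.
    by apply; move: iJ; rewrite expnS; nia.
  have F0 : (P (F 0%N) < +oo)%E by rewrite (probE P (mF 0%N)) ltry.
  have cv := nonincreasing_cvg_mu F0 mF mFI Fdec.
  have lim_eq := cvg_lim (@ereal_hausdorff R) cv.
  rewrite -lee_fin -(probE P mFI) -lim_eq; apply: lime_ge.
    by apply/cvg_ex; eexists; exact: cv.
  near=> m; rewrite /= (probE P (mF m)) lee_fin; apply: H => //.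
  by rewrite expn_gt0.
move=> w u Aw /andP[u0 uV].
have e20 : 0 < e / 2 by rewrite divr_gt0.
have [eta eta0 cont] := path_continuous w u0 e20.
have [m [i [iu ui]]] := dyadic_below d0 eta0 u0.
set v := i%:R * _ in iu ui.
have v0 : 0 <= v by rewrite mulr_ge0// divr_ge0// ltW.
have := cont v v0; rewrite ger0_norm ?subr_ge0// => /(_ ui) close.
have := Aw m I i; rewrite /= /walk -/v => Hv.
have {}Hv : `|y + W v w| <= (a + v) `^ kappa - e / 2.
  apply: Hv; rewrite ltnS -(ler_nat R).
  have m0 : 0 < (2 ^ m)%:R :> R by rewrite ltr0n expn_gt0.
  have : v <= (2 ^ J * M)%:R * delta by lra.
  rewrite /v mulrA ler_pdivrMr// mulnA !natrM; move=> Hi.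
  by rewrite -(ler_pM2r d0); lra.
have : (a + v) `^ kappa <= (a + u) `^ kappa.
  by apply: ler_powR_base => //; [lra|rewrite addr_ge0// ltW|rewrite lerD2l].
have := ler_normD (y + W v w) (W u w - W v w).
have -> : y + W v w + (W u w - W v w) = y + W u w by ring.
lra.
Unshelve. all: by end_near.
Qed.

End survival.

(** * The conditional law *)

Section survive.
Context {d : measure_display} {Omega : measurableType d} {R : realType}
  (P : probability Omega R) (W : R -> Omega -> R) (hW : is_standard_BM P W)
  (kappa s : R) (s0 : 0 <= s).
Local Notation pr := (prob P).

Lemma powR_cvg_within (p u : R) : s <= u ->
  (v + 1) `^ p @[v --> within [set v : R | s <= v] (nbhs u)] --> (u + 1) `^ p.
Proof.
move=> su.
have u0 : (0 : R) < u + 1 by exact: (ltr_wpDl (le_trans s0 su) ltr01).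
apply: (@cvg_trans _ ((fun v : R => expR (p * ln (v + 1))) @
    within [set u : R | s <= u] (nbhs u))).
  apply: fmap_within_eq => v; rewrite inE /= => sv.
  by rewrite /powR gt_eqF//; exact: (ltr_wpDl (le_trans s0 sv) ltr01).
have -> : (u + 1) `^ p = expR (p * ln (u + 1)).
  by rewrite /powR gt_eqF.
apply: cvg_within_filter.
apply: (@cvg_comp _ _ _ (fun v : R => p * ln (v + 1)) expR _
  (nbhs (p * ln (u + 1)))); last exact: continuous_expR.
apply: cvgM; first exact: cvg_cst.
apply: continuous_cvg; first exact: continuous_ln.
by apply: cvgD; [exact: cvg_id|exact: cvg_cst].
Qed.

Lemma Xproc_cvg_within x w (u : R) : s <= u ->
  Xproc kappa s x W v w @[v --> within [set v : R | s <= v] (nbhs u)] -->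
  Xproc kappa s x W u w.
Proof.
move=> su.
have u0 : (0 : R) < u + 1 by exact: (ltr_wpDl (le_trans s0 su) ltr01).
apply: cvgM.
  apply: cvgD; first exact: cvg_cst.
  apply: (@cvg_comp _ _ _ (fun v : R => v - s) (fun v => W v w) _
     (within [set v | 0 <= v] (nbhs (u - s)))).
    move=> A HA.
    have /(_ _ HA) H : (fun v : R => v - s) @ nbhs u --> nbhs (u - s).
      by apply: cvgB; [exact: cvg_id|exact: cvg_cst].
    suff : nbhs u (fun v : R => s <= v -> A (v - s)) by [].
    have {}H : nbhs u (fun v : R => 0 <= v - s -> A (v - s)) := H.
    apply: filterS H => v /= Hv sv.
    by apply: Hv; rewrite subr_ge0.
  case: hW => _ /(_ w) /subspace_continuousP cW _ _; apply: cW => /=.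
  by rewrite subr_ge0.
apply: cvgV; first by rewrite gt_eqF// powR_gt0.
exact: powR_cvg_within.
Qed.

Lemma Xproc_near x w (u e : R) : s <= u -> 0 < e ->
  exists2 eta : R, 0 < eta & forall v, s <= v -> `|u - v| < eta ->
    `|Xproc kappa s x W u w - Xproc kappa s x W v w| < e.
Proof.
move=> su e0; have /cvgrPdist_lt /(_ e e0) := @Xproc_cvg_within x w u su.
rewrite near_withinE => /nbhs_ballP[eta /= eta0 H].
by exists eta => // v sv uv; exact: H.
Qed.

Local Notation grid k i := (s + i%:R * (1 / (2 ^ k)%:R)).

(* Continuity of the path turns survival into a countable condition, jointly
   measurable in the starting point and the path. *)
Lemma surviveP x w t : s <= t -> survive kappa s x W t w <->
  exists n m : nat, forall k i : nat, grid k i < t + n.+1%:R^-1 ->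
    m.+1%:R^-1 <= `| `|Xproc kappa s x W (grid k i) w| - 1|.
Proof.
move=> st; split.
  rewrite /survive /= => Ht.
  (* Room beyond [t] is recorded in [n] so that the converse recovers the strict inequality for the
     infimum [tauX]. *)
  have [n Hn] : exists n : nat, ((t + n.+1%:R^-1)%:E < tauX kappa s x W w)%E.
    case: (tauX _ _ _ _ _) Ht => [r||]//.
      rewrite lte_fin => tr; exists (Num.trunc (r - t)^-1); rewrite lte_fin.
      have rt : 0 < r - t by rewrite subr_gt0.
      have := truncnS_gt (r - t)^-1.
      by move=> H; rewrite addrC -ltrBrDr -[ltRHS]invrK ltf_pV2 ?posrE ?invr_gt0.
    by move=> _; exists 0%N; rewrite ltry.
  have n0 : 0 < n.+1%:R^-1 :> R by rewrite invr_gt0.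
  pose f (u : R) : R := `| `|Xproc kappa s x W u w| - 1|.
  have stn : s <= t + n.+1%:R^-1 by rewrite (le_trans st)// lerDl ltW.
  have fc : {within `[s, t + n.+1%:R^-1], continuous f}.
    have sub : `[s, t + n.+1%:R^-1]%classic `<=` [set u | s <= u].
      by move=> u /=; rewrite in_itv/= => /andP[].
    have cX : {within [set u | s <= u],
        continuous ((fun u => Xproc kappa s x W u w) : R -> R)}.
      by apply/subspace_continuousP => u; exact: Xproc_cvg_within.
    have /subspace_continuousP H := continuous_subspaceW sub cX.
    apply/subspace_continuousP => u su.
    by apply: cvg_norm; apply: cvgB; [apply: cvg_norm; exact: H|exact: cvg_cst].
  (* The minimum over the compact interval is positive because no hit occurs there; it provides
     [m]. *)
  have [c cs cmin] := EVT_min stn fc.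
  have fc0 : 0 < f c.
    rewrite normr_gt0 subr_eq0; apply/eqP => Xc1.
    move: cs; rewrite in_itv/= => /andP[sc ct].
    have : (tauX kappa s x W w <= c%:E)%E by apply: ereal_inf_lbound; exists c.
    by move=> /(lt_le_trans Hn); rewrite lte_fin ltNge ct.
  exists n, (Num.trunc (f c)^-1) => k i qt.
  apply: (@le_trans _ _ (f c)).
    rewrite -[leRHS]invrK lef_pV2 ?posrE ?invr_gt0//.
    by rewrite ltW// truncnS_gt.
  apply: cmin; rewrite in_itv/= (ltW qt) andbT lerDl mulr_ge0//.
move=> [n [m H]]; rewrite /survive /=.
apply: (@lt_le_trans _ _ (t + n.+1%:R^-1)%:E).
  by rewrite lte_fin ltrDl invr_gt0.
apply: le_ereal_inf_tmp => _ [u [su Xu] <-]; rewrite lee_fin leNgt.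
apply/negP => ut.
have m0 : 0 < m.+1%:R^-1 :> R by rewrite invr_gt0.
have [eta eta0 near_u] := Xproc_near x w su m0.
have us0 : 0 <= u - s by rewrite subr_ge0.
have [k [i [iu ui]]] := dyadic_below ltr01 eta0 us0.
have sg : s <= grid k i by rewrite lerDl mulr_ge0// divr_ge0.
have gu : grid k i <= u by lra.
have := near_u _ sg; rewrite ger0_norm ?subr_ge0//.
have ge : u - grid k i < eta by lra.
move=> /(_ ge); have := H k i (le_lt_trans gu ut).
move=> H1 H2.
have := ler_dist_dist (Xproc kappa s x W u w) (Xproc kappa s x W (grid k i) w).
rewrite Xu (distrC 1) => H3.
by have := le_lt_trans (le_trans H1 H3) H2; rewrite ltxx.
Qed.

Lemma measurable_Xproc t : measurable_fun setT
  (fun z : R * Omega => Xproc kappa s z.1 W t z.2).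
Proof.
apply: measurable_funM => //; apply: measurable_funD.
  by apply: measurable_funM => //; exact: measurable_fst.
apply: (measurableT_comp (f := W (t - s))); last exact: measurable_snd.
by case: hW => _ _ + _; apply.
Qed.

Lemma measurable_survive t : s <= t -> measurable
  [set z : R * Omega | survive kappa s z.1 W t z.2].
Proof.
move=> st.
rewrite (_ : [set z | _] = \bigcup_n \bigcup_m \bigcap_k \bigcap_i
  [set z : R * Omega | grid k i < t + n.+1%:R^-1 ->
    m.+1%:R^-1 <= `| `|Xproc kappa s z.1 W (grid k i) z.2| - 1| ]); last first.
  apply/seteqP; split => z /=.
    move=> /(surviveP _ _ st)[n [m H]]; exists n => //; exists m => // k _ i _ /=.
    exact: H.
  move=> [n _ [m _ H]]; apply/(surviveP _ _ st); exists n, m => k i.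
  exact: (H k I i I).
apply: bigcupT_measurable => n; apply: bigcupT_measurable => m.
apply: bigcap_measurableType => k _; apply: bigcap_measurableType => i _.
have [ltg|geg] := ltP (grid k i) (t + n.+1%:R^-1); last first.
  rewrite (_ : [set z | _] = setT)//; apply/seteqP; split => // z _.
rewrite (_ : [set z | _] =
  (fun z : R * Omega => `|Xproc kappa s z.1 W (grid k i) z.2| - 1) @^-1`
  [set x : R | m.+1%:R^-1 <= `|x|]); last first.
  by apply/seteqP; split => z /=; [apply|].
rewrite -[X in measurable X]setTI.
suff : measurable_fun setT
  (fun z : R * Omega => `|Xproc kappa s z.1 W (grid k i) z.2| - 1).
  by apply => //; exact: measurable_norm_ge.
apply: measurable_funB => //; apply: measurableT_comp => //.
exact: measurable_Xproc.
Qed.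

End survive.

(** * Integrals of a bounded function of a concentrated variable *)

Section concentration.
Context {d : measure_display} {T : measurableType d} {R : realType}
  (nu : probability T R).
Implicit Types (S : set T) (g : T -> R).

Lemma bounded_integrable S g (K : R) : measurable S -> measurable_fun setT g ->
  (forall z, `|g z| <= K) -> nu.-integrable S (EFin \o g).
Proof.
move=> mS mg gK; apply: measurable_bounded_integrable => //.
- by apply: le_lt_trans (probability_le1 nu mS) _; rewrite ltry.
- exact: measurable_funTS.
- exists K; split; first exact: num_real.
  by move=> r Kr z _ /=; exact: le_trans (gK z) (ltW Kr).
Qed.

(** Pointwise, $|f(X)-f(0)|\le\eta+2M\,1_{|X|\ge\delta}$. The far event is then bounded without
    intersecting it with [S], so the conditioning event may depend on [X] in any way. *)
Lemma Rintegral_concentration S (X : T -> R) (f : R -> R) (M eta delta : R) :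
  measurable S -> measurable_fun setT X -> continuous f ->
  (forall y, `|f y| <= M) ->
  (forall y, `|y| < delta -> `|f y - f 0| <= eta) -> 0 <= eta ->
  `|\int[nu]_(z in S) f (X z) - f 0 * prob nu S| <=
  eta * prob nu S + 2 * M * prob nu [set z | delta <= `|X z|].
Proof.
move=> mS mX cf fM fd eta0.
have M0 : 0 <= M by apply: le_trans (fM 0).
have mF : measurable [set z | delta <= `|X z|].
  by rewrite -[X in measurable X]setTI; exact: (mX measurableT _ (measurable_norm_ge delta)).
set F := [set z | _] in mF *.
have mfX : measurable_fun setT (f \o X).
  by apply: measurableT_comp => //; exact: continuous_measurable_fun.
have mfX0 : measurable_fun setT (fun z => f (X z) - f 0) by exact: measurable_funB.
have b0 z : `|f (X z) - f 0| <= 2 * M.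
  by apply: le_trans (ler_normB _ _) _; have := fM (X z); have := fM 0; lra.
have i1 : nu.-integrable S (EFin \o (f \o X)).
  by apply: bounded_integrable mS mfX _ => z; exact: fM.
have i2 : nu.-integrable S (EFin \o cst (f 0)).
  by apply: (bounded_integrable (K := M)) => // z; exact: fM.
have i3 : nu.-integrable S (EFin \o (fun z => f (X z) - f 0)).
  exact: bounded_integrable mS mfX0 b0.
have i4 : nu.-integrable S (EFin \o (fun z => `|f (X z) - f 0|)).
  apply: (bounded_integrable (K := 2 * M)) => //; first exact: measurableT_comp.
  by move=> z; rewrite normr_id.
have m1F : measurable_fun setT (\1_F : T -> R) by exact: measurable_indic.
have b1 z : `|\1_F z : R| <= 1 by rewrite indicE; case: (_ \in _); rewrite ?normr1 ?normr0.
have i5 : nu.-integrable S (EFin \o (\1_F : T -> R)).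
  exact: bounded_integrable mS m1F b1.
have i6 : nu.-integrable S (EFin \o (fun z => 2 * M * \1_F z : R)).
  apply: (bounded_integrable (K := 2 * M)) => //; first exact: measurable_funM.
  move=> z; rewrite normrM ger0_norm ?mulr_ge0//.
  by rewrite -[leRHS]mulr1 ler_wpM2l ?mulr_ge0.
have i7 : nu.-integrable S (EFin \o cst eta).
  by apply: (bounded_integrable (K := eta)) => // z; rewrite /= ger0_norm.
have i8 : nu.-integrable S (EFin \o (fun z => eta + 2 * M * \1_F z : R)).
  have := integrableD mS i7 i6; congr (_.-integrable _ _).
have -> : f 0 * prob nu S = \int[nu]_(z in S) f 0 by rewrite Rintegral_cst.
rewrite -(RintegralB mS i1 i2).
apply: le_trans (le_normr_Rintegral mS i3) _.
apply: (@le_trans _ _ (\int[nu]_(z in S) (eta + 2 * M * \1_F z))).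
  apply: le_Rintegral => // z _.
  have [zF|zF] := pselect (F z).
    rewrite indicE mem_set//= mulr1; have := b0 z; lra.
  rewrite indicE memNset//= mulr0 addr0; apply: fd.
  by rewrite ltNge; apply/negP.
rewrite (RintegralD mS i7 i6) Rintegral_cst// lerD2l RintegralZl//.
rewrite ler_wpM2l ?mulr_ge0// /Rintegral integral_indic//.
by apply: le_prob => //; exact: measurableI.
Qed.

End concentration.

(** * Survival and concentration under the initial law *)

Section conditional.
Context {d : measure_display} {Omega : measurableType d} {R : realType}
  (P : probability Omega R) (W : R -> Omega -> R) (hW : is_standard_BM P W)
  (mu : probability R R) (hmu : mu `]-1, 1[%classic = 1%E)
  (kappa s : R) (hk : 1 / 2 < kappa) (s0 : 0 <= s).

(** $\mathbb{P}_{\mu,s}$ realised on pairs of a starting point and a path, so that the iterated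
    integrals become integrals against one probability. *)
Definition joint : probability _ R := (mu \x P)%E.
Definition survivors (t : R) : set (R * Omega) := 
  [set z | survive kappa s z.1 W t z.2].
Local Notation X t := (fun z : R * Omega => Xproc kappa s z.1 W t z.2).

Lemma surv_probE t : surv_prob P mu kappa s W t = joint (survivors t).
Proof.
rewrite /surv_prob /joint /= /product_measure1; apply: eq_integral => x _ /=.
by rewrite xsectionE.
Qed.

Lemma surv_expectE (f : R -> R) (M t : R) : s <= t -> continuous f ->
  (forall y, `|f y| <= M) ->
  fine (surv_expect P mu kappa s W f t) = \int[joint]_(z in survivors t) f (X t z).
Proof.
move=> st cf fM; rewrite /Rintegral; congr fine.
have mS := measurable_survive hW kappa s0 st.
have mX := measurable_Xproc hW kappa s t.
have mf : measurable_fun setT (fun z => f (X t z)).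
  by apply: measurableT_comp => //; exact: continuous_measurable_fun.
have := bounded_integrable joint mS mf (fun z => fM (X t z)).
move=> /(integrable_mkcond _ mS) iF.
rewrite integral_mkcond -(integral12_prod_meas1 iF).
rewrite /surv_expect; apply: eq_integral => x _ /=.
rewrite /fubini_F [LHS]integral_mkcond; apply: eq_integral => w _.
rewrite !patchE; congr (if _ then _ else _).
Qed.

(** The survival bound is uniform only away from $\pm1$. If every compact of an exhausting sequence
    were null, so would be $(-1,1)$. *)
Lemma mass_in_compact : exists2 rho : R, rho < 1 &
  0 < fine (mu `[- rho, rho]%classic).
Proof.
pose F (n : nat) := `[- (1 - n.+1%:R^-1) : R, 1 - n.+1%:R^-1]%classic.
have [[n Hn]|H] := pselect (exists n, 0 < fine (mu (F n))).
  by exists (1 - n.+1%:R^-1) => //; rewrite ltrBlDr ltrDl invr_gt0.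
exfalso; have F0 n : mu (F n) = 0%E.
  have mF : measurable (F n) by exact: measurable_itv.
  rewrite -[LHS]fineK ?fin_num_measure//; congr EFin; apply/eqP.
  rewrite eq_le fine_ge0 ?measure_ge0// andbT leNgt; apply/negP => ?.
  by apply: H; exists n.
have sub : `]-1, 1[%classic `<=` \bigcup_n F n.
  move=> x /=; rewrite in_itv/= -ltr_norml => x1.
  have x0 : 0 < 1 - `|x| by rewrite subr_gt0.
  exists (Num.trunc (1 - `|x|)^-1) => //=; rewrite /F/= in_itv/= -ler_norml.
  have := truncnS_gt (1 - `|x|)^-1; set k := _.+1 => Hk.
  have : k%:R^-1 < 1 - `|x| by rewrite -[ltRHS]invrK ltf_pV2 ?posrE ?invr_gt0.
  lra.
have mFU : measurable (\bigcup_n F n).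
  by apply: bigcupT_measurable => n; exact: measurable_itv.
have : (mu `](-1)%R, 1%R[%classic <= mu (\bigcup_n F n))%E.
  by apply: le_measure => //; rewrite inE; [exact: measurable_itv|exact: mFU].
rewrite hmu measure_negligible ?lee_fin ?ler10//.
apply: negligible_bigcup => n; apply/negligibleP; first exact: measurable_itv.
exact: F0.
Qed.

Lemma surv_prob_lower : exists2 c : R, 0 < c & forall t, s <= t -> c <= prob joint (survivors t).
Proof.
have [rho rho1 mrho] := mass_in_compact.
pose a := s + 1; have a0 : 0 < a by exact: (ltr_wpDl s0 ltr01).
have ak0 : 0 < a `^ kappa by exact: powR_gt0.
(* This is the margin for which $|x|\le\rho$ gives $|x|a^\kappa+2e\le a^\kappa$. *)
pose e := (1 - rho) / 2 * a `^ kappa.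
have e0 : 0 < e by rewrite mulr_gt0// divr_gt0// subr_gt0.
have [c c0 Hc] := path_survival hW hk a0 e0.
have mI : measurable (`[- rho, rho]%classic : set R).
  exact: measurable_itv.
exists (c * fine (mu `[- rho, rho]%classic)); first exact: mulr_gt0.
move=> t st.
have mS := measurable_survive hW kappa s0 st.
rewrite -lee_fin -(probE joint mS) -surv_probE EFinM fineK ?fin_num_measure//.
have mG : measurable_fun setT (fun x : R => P (survive kappa s x W t)).
  have := measurable_fun_xsection P mS; congr (measurable_fun _ _).
  by apply/funext => x /=; rewrite xsectionE.
rewrite -(integral_cst mu mI) /surv_prob.
apply: (@le_trans _ _ (\int[mu]_(x in `[(- rho)%R, rho]) P (survive kappa s x W t))%E); last first.
  by apply: ge0_subset_integral.
apply: ge0_le_integral => //.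
- by move=> x _; rewrite lee_fin ltW.
- exact: measurable_funTS.
move=> x /=; rewrite in_itv/= -ler_norml => xrho.
have hy : `|x * a `^ kappa| + 2 * e <= a `^ kappa.
  rewrite normrM (ger0_norm (ltW ak0)) /e.
  have := ler_wpM2r (ltW ak0) xrho; lra.
(* The horizon reaches one unit past [t], which makes [tauX] at least [t + 1] and so strictly above
   [t]. *)
have [A [mA cA HA]] := Hc (t + 1 - s) _ hy.
have mSx : measurable (survive kappa s x W t).
  by have := measurable_xsection x mS; rewrite xsectionE.
rewrite (probE P mSx) lee_fin (le_trans cA)//; apply: le_prob => // w Aw.
rewrite /survive /=.
apply: (@lt_le_trans _ _ (t + 1)%:E); first by rewrite lte_fin ltrDl.
apply: le_ereal_inf_tmp => _ [u [su Xu] <-]; rewrite lee_fin leNgt.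
apply/negP => ut.
have us : 0 <= u - s <= t + 1 - s by rewrite subr_ge0 su lerD2r ltW.
have := HA w (u - s) Aw us.
have -> : a + (u - s) = u + 1 by rewrite /a; ring.
have u0 : 0 < u + 1 by exact: (ltr_wpDl (le_trans s0 su) ltr01).
have uk0 : 0 < (u + 1) `^ kappa by exact: powR_gt0.
move: Xu; rewrite /Xproc normrM normfV (ger0_norm (ltW uk0)) -/a => Xu.
by rewrite -[Y in Y < _](divfK (lt0r_neq0 uk0)) Xu mul1r ltxx.
Qed.


(** For [t] this large, the starting term takes at most half of $\delta(t+1)^\kappa$, so [W] must
    supply the other half. Starting points outside $(-1,1)$ are [mu]-null. *)
Lemma far_prob_le t (delta : R) : s < t -> 0 < delta ->
  2 * (s + 1) `^ kappa / delta <= (t + 1) `^ kappa ->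
  prob joint [set z | delta <= `|X t z|] <=
  16 / delta ^+ 2 * ((t + 1) / ((t + 1) `^ kappa) ^+ 2).
Proof.
move=> st d0 tlarge.
have t1 : 0 < t + 1 by exact: (ltr_wpDl (le_trans s0 (ltW st)) ltr01).
set b := (t + 1) `^ kappa in tlarge *.
have b0 : 0 < b by exact: powR_gt0.
have a0 : 0 < s + 1 by exact: (ltr_wpDl s0 ltr01).
set a := (s + 1) `^ kappa in tlarge *.
have ak0 : 0 < a by exact: powR_gt0.
pose l := delta * b / 2.
have l0 : 0 < l by rewrite divr_gt0// mulr_gt0.
have al : a <= l.
  by move: tlarge; rewrite ler_pdivrMr// /l; lra.
pose O := ~` (`](-1)%R, 1%R[%classic : set R).
have mO : measurable O by apply: measurableC; exact: measurable_itv.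
pose B := [set w : Omega | l <= `|W (t - s) w|].
have mW : measurable_fun setT (W (t - s)) by case: hW => _ _ + _; apply.
have mB : measurable B.
  by rewrite -[Y in measurable Y]setTI; exact: (mW measurableT _ (measurable_norm_ge l)).
have mF : measurable [set z | delta <= `|X t z|].
  rewrite -[Y in measurable Y]setTI.
  exact: (measurable_Xproc hW kappa s t measurableT (measurable_norm_ge delta)).
have mOT : measurable (O `*` [set: Omega]) by exact: measurableX.
have mTB : measurable ([set: R] `*` B) by exact: measurableX.
have sub : [set z | delta <= `|X t z|] `<=` (O `*` [set: Omega]) `|` ([set: R] `*` B).
  move=> [x w] /= Hx; have [xO|xO] := pselect (O x); [by left|right; split => //].
  have x1 : `|x| < 1.
    by move: xO => /contrapT /=; rewrite in_itv/= -ltr_norml.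
  move: Hx; rewrite /Xproc /= -/a -/b normrM normfV (ger0_norm (ltW b0)).
  rewrite ler_pdivlMr// => Hx; rewrite /B /=.
  have := ler_normD (x * a) (W (t - s) w).
  rewrite normrM (ger0_norm (ltW ak0)).
  have : `|x| * a <= a by rewrite ler_piMl ?ltW.
  by rewrite /l in al *; lra.
have piO : prob joint (O `*` [set: Omega]) = 0.
  rewrite /prob; have -> : joint (O `*` setT) = (mu O * P setT)%E.
    exact: product_measure1E.
  by rewrite /O probability_setC// hmu subee// mul0e.
have piB : prob joint ([set: R] `*` B) = prob P B.
  rewrite /prob; have -> : joint (setT `*` B) = (mu setT * P B)%E.
    exact: product_measure1E.
  by rewrite probability_setT mul1e.
have ts : 0 < t - s by rewrite subr_gt0.
have PB : prob P B <= 4 * (t - s) / l ^+ 2.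
  (* The increment bound is used for a single step of a grid with mesh [t - s]. *)
  have pT : past W (t - s) 0 setT by exact: pastT.
  have := prob_past_incr_ge hW ts (ltn0Sn 0) pT l0.
  rewrite setTI prob_setT mul1r subn0 mul1r; apply: le_trans.
  rewrite le_eqVlt; apply/orP; left; apply/eqP; congr (prob P _).
  by apply/seteqP; split => w /=; rewrite (walk0 hW) /walk subr0 mul1r.
apply: (le_trans (le_prob joint mF (measurableU _ _ mOT mTB) sub)).
apply: (le_trans (probU_le joint mOT mTB)); rewrite piO add0r piB.
apply: (le_trans PB).
have -> : 16 / delta ^+ 2 * ((t + 1) / b ^+ 2) = 4 * (t + 1) / l ^+ 2.
  by rewrite /l; field; rewrite !gt_eqF.
rewrite ler_pM2r ?invr_gt0 ?exprn_gt0// ler_pM2l// lerD2l.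
by rewrite (le_trans _ ler01)// oppr_le0.
Qed.

Lemma conditional_law_limit : cond_law_weakly_to_dirac0 P mu kappa s W.
Proof.
move=> f cf [M' fM']; pose M := Num.max M' 1.
have M0 : 0 < M by rewrite lt_max ltr01 orbT.
have fM y : `|f y| <= M by apply: le_trans (fM' y) _; rewrite le_max lexx.
have [c c0 Hc] := surv_prob_lower.
apply/cvgrPdist_lt => e e0.
have e40 : 0 < e / 4 by rewrite divr_gt0.
have [delta d0 Hd] : exists2 delta : R, 0 < delta &
    forall y, `|y| < delta -> `|f y - f 0| <= e / 4.
  have /cvgrPdist_lt /(_ _ e40) /nbhs_ballP[r /= r0 Hr] := cf 0.
  exists r => // y yr; rewrite distrC ltW//; apply: Hr.
  by rewrite /ball /= sub0r normrN.
have k0 : 0 < kappa by move: hk; lra.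
have k1 : 0 < 2 * kappa - 1 by move: hk; lra.
(* With $q=(t+1)^{1-2\kappa}$, the condition $Cq\le1$ turns the far bound into
   [2 * M * pfar <= e / 4 * c]. *)
pose C := 16 / delta ^+ 2 * (8 * M / (e * c)).
have C0 : 0 < C.
  apply: mulr_gt0; apply: divr_gt0; [by rewrite ltr0n|exact: exprn_gt0|
    exact: mulr_gt0|exact: mulr_gt0].
have [v1 [v10 H1]] := powR_large C k1.
have [v2 [v20 H2]] := powR_large (2 * (s + 1) `^ kappa / delta) k0.
near=> t.
have st : s < t by near: t; apply: nbhs_pinfty_gt; exact: num_real.
have tv1 : v1 <= t by near: t; apply: nbhs_pinfty_ge; exact: num_real.
have t1 : v1 <= t + 1 by rewrite (le_trans tv1)// lerDl.
have tv2 : v2 <= t by near: t; apply: nbhs_pinfty_ge; exact: num_real.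
have t2 : v2 <= t + 1 by rewrite (le_trans tv2)// lerDl.
have t0 : 0 < t + 1 by exact: lt_le_trans v10 t1.
have mS := measurable_survive hW kappa s0 (ltW st).
have mX := measurable_Xproc hW kappa s t.
have far := far_prob_le st d0 (H2 _ t2).
have := Rintegral_concentration joint mS mX cf fM Hd (ltW e40).
rewrite /cond_integral (surv_expectE (ltW st) cf fM) surv_probE.
rewrite -/(survivors t) -/(prob joint (survivors t)).
set I := Rintegral _ _ _; set Z := prob joint (survivors t).
set pfar := prob _ _ in far *.
have Zc : c <= Z by exact: Hc (ltW st).
have Z0 : 0 < Z by exact: lt_le_trans c0 Zc.
have HC : C <= ((t + 1) / ((t + 1) `^ kappa) ^+ 2)^-1.
  apply: le_trans (H1 _ t1) _; rewrite powRB; last first.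
    by rewrite (negbT (gt_eqF t0)) implybT.
  rewrite (mulrC 2) powRrM powRr1 ?(ltW t0)// powR_mulrn ?powR_ge0//.
  by rewrite invf_div.
set q := (t + 1) / _ in far HC.
have q0 : 0 < q by rewrite divr_gt0// exprn_gt0// powR_gt0.
have Cq : C * q <= 1 by rewrite -(mulVf (lt0r_neq0 q0)) ler_pM2r.
have farc : 2 * M * pfar <= e / 4 * c.
  have -> : e / 4 * c = 2 * M * (e * c / (8 * M)) by field; rewrite gt_eqF.
  rewrite ler_pM2l ?mulr_gt0//; apply: le_trans far _.
  have -> : 16 / delta ^+ 2 * q = C * q * (e * c / (8 * M)).
    by rewrite /C; field; rewrite !gt_eqF.
  have w0 : 0 <= e * c / (8 * M) by rewrite divr_ge0// ltW// mulr_gt0.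
  by rewrite -[leRHS]mul1r ler_wpM2r.
move=> HI.
(* Both errors are at most [e / 4 * Z], the second because [c <= Z]; their sum is below [e * Z]. *)
have -> : f 0 - I / Z = - ((I - f 0 * Z) / Z) by field; rewrite gt_eqF.
rewrite normrN normrM normfV (gtr0_norm Z0) ltr_pdivrMr//.
apply: le_lt_trans HI _.
have : e / 4 * c <= e / 4 * Z by rewrite ler_pM2l.
have : 0 < e * Z by exact: mulr_gt0.
lra.
Unshelve. all: by end_near.
Qed.

End conditional.

Unset Implicit Arguments. Set Strict Implicit. Set Printing Implicit Defensive.

Theorem theorem1 (R : realType) (kappa : R) (hkappa : 1 / 2 < kappa)
  (d : measure_display) (Omega : measurableType d) (P : probability Omega R)
  (W : R -> Omega -> R) (hW : is_standard_BM P W)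
  (mu : probability R R) (hmu : mu `]-1, 1[%classic = 1%E)
  (s : R) (hs : 0 <= s) :
  cond_law_weakly_to_dirac0 P mu kappa s W.
Proof. exact: (conditional_law_limit hW hmu hkappa hs). Qed.
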